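(* The following statements are equivalent: (i) The admissible pair $(u,\tau)$ is a standard pair of $\mathcal{O}_c$. (ii) The polytope $Q_u^{\bar\tau}$ is a standard polytope of $IP_{A,c}$. (iii) The face $\tau$ of $\Delta_c$ is associated to $IP_{A,c}$.
   Context: $\mathbb{N}$ denotes the non-negative integers. $A \in \mathbb{Z}^{d\times n}$ is a fixed matrix of rank $d$ with columns $a_1,\dots,a_n$; $\mathrm{cone}(A)=\{Au : u\in\mathbb{R}^n, u\ge 0\}$ is pointed and $\{u\in\mathbb{R}^n: Au=0, u\ge 0\}=\{0\}$; $\mathbb{N}A=\{Au: u\in\mathbb{N}^n\}$. For $b\in\mathbb{N}A$, $IP_{A,c}(b)$ is the program $\min\{c\cdot x: Ax=b, x\in\mathbb{N}^n\}$; $IP_{A,c}$ is the family of these programs. The cost vector $c\in\mathbb{Z}^n$ is generic, i.e. each $IP_{A,c}(b)$, $b\in\mathbb{N}A$, has a unique optimal solution. $\mathcal{O}_c\subset\mathbb{N}^n$ is the set of all optimal solutions of all programs in $IP_{A,c}$. For $\sigma\subseteq\{1,\dots,n\}$, $\bar\sigma$ is the complement, $A_\sigma$ the submatrix of columns indexed by $\sigma$, $x_\sigma$ the subvector indexed by $\sigma$. The regular triangulation $\Delta_c$ is the set of all $\sigma\subseteq\{1,\dots,n\}$ for which there is $y\in\mathbb{R}^d$ with $y\cdot a_j=c_j$ for $j\in\sigma$ and $y\cdot a_j<c_j$ for $j\notin\sigma$; its elements are called faces (by genericity, they label a complex of simplicial cones $\mathrm{cone}(A_\sigma)$ with support $\mathrm{cone}(A)$,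 whose maximal faces have $d$ elements). Group relaxation: for $\tau\in\Delta_c$ and $b\in\mathbb{N}A$, $G^\tau(b)$ is the program $\min\{\tilde c_{\bar\tau}\cdot x_{\bar\tau}: A_\tau x_\tau+A_{\bar\tau}x_{\bar\tau}=b,\ x_{\bar\tau}\ge 0,\ (x_\tau,x_{\bar\tau})\in\mathbb{Z}^n\}$, where $\tilde c_{\bar\tau}$ consists of the coordinates indexed by $\bar\tau$ of $c-c_\sigma A_\sigma^{-1}A$ for any maximal face $\sigma\supseteq\tau$ of $\Delta_c$. $G^\tau(b)$ solves $IP_{A,c}(b)$ if its optimal solution $(x_\tau^*,x_{\bar\tau}^* )\in\mathbb{Z}^n$ is non-negative (equivalently, equals the optimal solution of $IP_{A,c}(b)$). A face $\tau\in\Delta_c$ is associated to $IP_{A,c}$ (is an associated set of $IP_{A,c}$) if for some $b\in\mathbb{N}A$, $G^\tau(b)$ solves $IP_{A,c}(b)$ but $G^{\tau'}(b)$ does not, for all faces $\tau'\in\Delta_c$ with $\tau\subsetneq\tau'$. For $u\in\mathbb{N}^n$ and $\tau\in\Delta_c$, $S(u,\tau)=u+\mathbb{N}(e_i: i\in\tau)$, with $e_i$ the unit vectors of $\mathbb{R}^n$; $\mathrm{supp}(u)=\{i: u_i\ne 0\}$. For $\tau\in\Delta_c$ and $u\in\mathcal{O}_c$, $(u,\tau)$ is an admissible pair of $\mathcal{O}_c$ if $\mathrm{supp}(u)\subseteq\bar\tau$ and $S(u,\tau)\subseteq\mathcal{O}_c$. An admissible pair $(u,\tau)$ is a standard pair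 of $\mathcal{O}_c$ if $S(u,\tau)$ is not properly contained in $S(v,\tau')$ for another admissible pair $(v,\tau')$ of $\mathcal{O}_c$. Let $B\in\mathbb{Z}^{n\times(n-d)}$ be a matrix whose columns generate the lattice $\{x\in\mathbb{Z}^n: Ax=0\}$, let $B^{\bar\tau}$ be obtained from $B$ by deleting the rows indexed by $\tau$, and let $\pi_\tau(u)$ be $u$ with the coordinates indexed by $\tau$ deleted. For $u\in\mathbb{N}^n$ and $\tau\in\Delta_c$, $Q_u^{\bar\tau}=\{z\in\mathbb{R}^{n-d}: B^{\bar\tau}z\le\pi_\tau(u),\ (-cB)\cdot z\le 0\}$. It is a standard polytope of $IP_{A,c}$ if $Q_u^{\bar\tau}\cap\mathbb{Z}^{n-d}=\{0\}$ and every relaxation of $Q_u^{\bar\tau}$ obtained by removing an inequality in $B^{\bar\tau}z\le\pi_\tau(u)$ contains a non-zero lattice point. *)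

(* Defs.v *)
From mathcomp Require Import all_boot all_order all_algebra.
From mathcomp Require Import classical_sets reals.

Set Implicit Arguments.
Unset Strict Implicit.
Unset Printing Implicit Defensive.

Import Order.TTheory GRing.Theory Num.Theory.
Local Open Scope classical_set_scope.
Local Open Scope ring_scope.

(* N^n is rendered as the set of non-negative vectors of Z^n, so that integer
   programs and their group relaxations live in the same type 'cV[int]_n. *)
Definition nonneg (K : numDomainType) (n : nat) (x : 'cV[K]_n) : Prop :=
  forall i, 0 <= x i 0.

Definition mx_to_real (R : realType) (m n : nat) (M : 'M[int]_(m, n)) :
  'M[R]_(m, n) := map_mx intr M.

Definition int_points (R : realType) (k : nat) : set 'cV[R]_k :=
  range (fun z : 'cV[int]_k => mx_to_real R z).
Arguments int_points R k _ : clear implicits.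

Definition supp (n : nat) (u : 'cV[int]_n) : {set 'I_n} :=
  finset (fun i => u i 0 != 0).

Definition cone (R : realType) (d n : nat) (A : 'M[int]_(d, n)) :
  set 'cV[R]_d :=
  [set v | exists2 u : 'cV[R]_n, nonneg u & v = mx_to_real R A *m u].
Arguments cone R {d n} A _.

Definition pointed (R : realType) (d : nat) (C : set 'cV[R]_d) : Prop :=
  forall v, C v -> C (- v) -> v = 0.

Definition semigroup (d n : nat) (A : 'M[int]_(d, n)) : set 'cV[int]_d :=
  [set b | exists2 u : 'cV[int]_n, nonneg u & b = A *m u].

Definition ip_feasible (d n : nat) (A : 'M[int]_(d, n)) (b : 'cV[int]_d) :
  set 'cV[int]_n := [set x | A *m x = b /\ nonneg x].

Definition ip_optimal (d n : nat) (A : 'M[int]_(d, n)) (c : 'rV[int]_n)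
  (b : 'cV[int]_d) : set 'cV[int]_n :=
  [set x | ip_feasible A b x /\
           forall x', ip_feasible A b x' -> (c *m x) 0 0 <= (c *m x') 0 0].

Definition generic (d n : nat) (A : 'M[int]_(d, n)) (c : 'rV[int]_n) : Prop :=
  forall b, semigroup A b -> exists! x, ip_optimal A c b x.

Definition opt_sols (d n : nat) (A : 'M[int]_(d, n)) (c : 'rV[int]_n) :
  set 'cV[int]_n :=
  [set x | exists2 b, semigroup A b & ip_optimal A c b x].

(* Membership of s in the regular triangulation Delta_c. *)
Definition face (R : realType) (d n : nat) (A : 'M[int]_(d, n))
  (c : 'rV[int]_n) (s : {set 'I_n}) : Prop :=
  exists y : 'rV[R]_d,
    (forall j, j \in s -> (y *m mx_to_real R A) 0 j = (c 0 j)%:~R) /\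
    (forall j, j \notin s -> (y *m mx_to_real R A) 0 j < (c 0 j)%:~R).

Definition maximal_face (R : realType) (d n : nat) (A : 'M[int]_(d, n))
  (c : 'rV[int]_n) (s : {set 'I_n}) : Prop :=
  face R A c s /\ forall s', face R A c s' -> ~~ (s \proper s').

Definition col_subset (K : Type) (m n : nat) (M : 'M[K]_(m, n))
  (s : {set 'I_n}) : 'M[K]_(m, #|s|) :=
  colsub (fun k : 'I_#|s| => enum_val k) M.

(* c - c_s A_s^-1 A.  For a maximal face s one has #|s| = d and A_s is
   invertible; since its column count is #|s| rather than literally d, the
   inverse is written pinvmx, which is then the two-sided inverse of A_s. *)
Definition reduced_cost (R : realType) (d n : nat) (A : 'M[int]_(d, n))
  (c : 'rV[int]_n) (s : {set 'I_n}) : 'rV[R]_n :=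
  mx_to_real R c -
  col_subset (mx_to_real R c) s *m pinvmx (col_subset (mx_to_real R A) s) *m
    mx_to_real R A.

Definition gr_feasible (d n : nat) (A : 'M[int]_(d, n)) (t : {set 'I_n})
  (b : 'cV[int]_d) : set 'cV[int]_n :=
  [set x | A *m x = b /\ forall j, j \notin t -> 0 <= x j 0].

Definition gr_cost (R : realType) (n : nat) (ct : 'rV[R]_n) (t : {set 'I_n})
  (x : 'cV[int]_n) : R :=
  \sum_(j in ~: t) ct 0 j * (x j 0)%:~R.

Definition gr_optimal (R : realType) (d n : nat) (A : 'M[int]_(d, n))
  (ct : 'rV[R]_n) (t : {set 'I_n}) (b : 'cV[int]_d) : set 'cV[int]_n :=
  [set x | gr_feasible A t b x /\
           forall x', gr_feasible A t b x' -> gr_cost ct t x <= gr_cost ct t x'].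

(* The choice of the maximal face s containing t is immaterial: on the feasible
   set of G^t(b), two choices give costs that differ by a constant. *)
Definition gr_solves (R : realType) (d n : nat) (A : 'M[int]_(d, n))
  (c : 'rV[int]_n) (t : {set 'I_n}) (b : 'cV[int]_d) : Prop :=
  exists s : {set 'I_n}, [/\ maximal_face R A c s, t \subset s &
    exists2 x, gr_optimal A (reduced_cost R A c s) t b x & nonneg x].

Definition associated (R : realType) (d n : nat) (A : 'M[int]_(d, n))
  (c : 'rV[int]_n) (t : {set 'I_n}) : Prop :=
  face R A c t /\
  exists b, [/\ semigroup A b, gr_solves R A c t b &
    forall t', face R A c t' -> t \proper t' -> ~ gr_solves R A c t' b].

(* S(u, t) = u + N(e_i : i in t). *)
Definition translate (n : nat) (u : 'cV[int]_n) (t : {set 'I_n}) :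
  set 'cV[int]_n :=
  [set x | exists m : 'I_n -> nat,
     x = u + \sum_(i in t) (m i)%:Z *: delta_mx i 0].

Definition admissible_pair (R : realType) (d n : nat) (A : 'M[int]_(d, n))
  (c : 'rV[int]_n) (u : 'cV[int]_n) (t : {set 'I_n}) : Prop :=
  [/\ face R A c t, opt_sols A c u, supp u \subset ~: t &
      translate u t `<=` opt_sols A c].

Definition standard_pair (R : realType) (d n : nat) (A : 'M[int]_(d, n))
  (c : 'rV[int]_n) (u : 'cV[int]_n) (t : {set 'I_n}) : Prop :=
  admissible_pair R A c u t /\
  forall v t', admissible_pair R A c v t' ->
    ~ (translate u t `<` translate v t').

Definition generates_kernel (d n k : nat) (A : 'M[int]_(d, n))
  (B : 'M[int]_(n, k)) : Prop :=
  forall x : 'cV[int]_n, A *m x = 0 <-> exists z : 'cV[int]_k, x = B *m z.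

(* {z | (B z)_i <= u_i for i in rows, (- c B) . z <= 0}.  The polytope Q_u is
   the case rows = ~: t; removing the inequality of index i from it gives the
   case rows = ~: t :\ i. *)
Definition polyQ (R : realType) (n k : nat) (B : 'M[int]_(n, k))
  (c : 'rV[int]_n) (u : 'cV[int]_n) (rows : {set 'I_n}) : set 'cV[R]_k :=
  [set z | (forall i, i \in rows -> (mx_to_real R B *m z) i 0 <= (u i 0)%:~R) /\
           (mx_to_real R (- (c *m B)) *m z) 0 0 <= 0].
Arguments polyQ R {n k} B c u rows _.

Definition standard_polytope (R : realType) (n k : nat) (B : 'M[int]_(n, k))
  (c : 'rV[int]_n) (u : 'cV[int]_n) (t : {set 'I_n}) : Prop :=
  polyQ R B c u (~: t) `&` int_points R k = [set 0] /\
  forall i, i \in ~: t ->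
    exists z, [/\ polyQ R B c u (~: t :\ i) z, int_points R k z & z <> 0].

(* Main.v *)
Require Import Defs.
From mathcomp Require Import all_boot all_order all_algebra.
From mathcomp Require Import boolp classical_sets reals.

Set Implicit Arguments.
Unset Strict Implicit.
Unset Printing Implicit Defensive.

Import Order.TTheory GRing.Theory Num.Theory.
Local Open Scope classical_set_scope.
Local Open Scope ring_scope.

(** All three conditions are rewritten in terms of one notion.  Call [u] optimal
    for the relaxation at [s] when it minimises [c] among the integer points [x]
    with [A x = A u] whose coordinates outside [s] are non-negative
    ([relax_opt]), and call [u] maximally relaxed at [t] when it is optimal for
    the relaxation at [t] but at no [i |: t] with [i] outside [t].  Up to
    changing the coordinates of [u] in [t], which affects neither notion, (i)
    and (ii) say that the non-negative vector [u] is maximally relaxed at [t],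
    and (iii) that some non-negative vector is.

    - Group relaxations: the reduced cost vanishes on [t] and differs from [c]
      by a combination of the rows of [A], so on a fibre of [A] it orders the
      points as [c] does ([gr_costE]).  Hence [G^t(b)] solves the program iff
      the fibre of [b] has a non-negative point optimal for the relaxation at
      [t] ([gr_solvesP]).
    - Standard pairs: [S(u, t)] consists of optimal solutions iff [u] is optimal
      for the relaxation at [t], because any competitor becomes non-negative
      after adding a large vector supported on [t] ([translate_opt_sols]).
      Enlarging the pair means enlarging [t].
    - Standard polytopes: [z |-> u - B z] identifies lattice points with the
      fibre of [u], a bijection since the columns of [B] are independent
      ([kernel_basis_free]).  A lattice point of the polytope is a competitor of
      [u] that costs no more, and dropping the inequality [i] relaxes the sign
      of coordinate [i].  Genericity makes minimisers unique
      ([relax_opt_uniq]), so that the origin is the only lattice point iff [u]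
      is optimal.

    The definitions quantify over different sets: the polytope tests every
    [i |: t], whereas associated sets and standard pairs only test larger faces.
    These agree because a set [s] for which the relaxation at [s] has a
    non-negative optimal point is necessarily a face ([face_of_relax_opt]).
    This is linear programming duality: if [s] is not a face, a theorem of the
    alternative ([regular_face_alternative], obtained from [gordan_mod]) gives a
    non-zero rational vector in the kernel of [A], non-negative outside [s] and
    of cost at most 0; a positive integer multiple of it, added to [u],
    contradicts the uniqueness of the minimiser. *)

(** * Theorems of the alternative *)

Lemma small_perturbation (F : realFieldType) (p : nat) (a b : 'cV[F]_p) :
  (forall i, a i 0 < 0) ->
  exists2 e : F, 0 < e & forall i, (a + e *: b) i 0 < 0.
Proof.
move=> a_lt0.
suff [e e_gt0 he] : exists2 e : F, 0 < e & forall i, e * b i 0 < - a i 0.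
  by exists e => // i; rewrite !mxE addrC -ltrBrDr sub0r.
pose f i := `|b i 0| / - a i 0.
have f_ge0 i : 0 <= f i by rewrite divr_ge0 // oppr_ge0 ltW.
have S_gt0 : 0 < 1 + \sum_i f i by rewrite ltr_pwDl // sumr_ge0.
exists (1 + \sum_i f i)^-1; first by rewrite invr_gt0.
move=> i; rewrite mulrC ltr_pdivrMr //.
have na_gt0 : 0 < - a i 0 by rewrite oppr_gt0.
apply: (le_lt_trans (ler_norm _)).
rewrite -ltr_pdivrMl // mulrC (bigD1 i) //= -/(f i) addrCA ltrDl.
by rewrite ltr_pwDl // sumr_ge0.
Qed.

(** Gordan's theorem modulo the row space of [L]: equality constraints are kept
    apart from the strict ones.  The proof adds the rows of [V] one at a time.
    If [z] is negative on the old rows but positive on the new row [v], the old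
    rows are projected along [v] onto the hyperplane [z = 0], with positive
    coefficients; this turns a non-negative combination of the projected rows
    into one of the original rows. *)
Lemma gordan_mod (F : realFieldType) (m q : nat) (L : 'M[F]_(q, m)) (p : nat)
  (V : 'M[F]_(p, m)) :
  (exists z : 'cV[F]_m, L *m z = 0 /\ forall i, (V *m z) i 0 < 0) \/
  (exists w : 'rV[F]_p,
     [/\ forall i, 0 <= w 0 i, w != 0 & (w *m V <= L)%MS]).
Proof.
elim: p V => [|p IHp] V.
  by left; exists 0; split=> [|[]//]; rewrite mulmx0.
move: V; rewrite -[p.+1]/(1 + p)%N => V; rewrite -(vsubmxK V).
move: (usubmx _) (dsubmx _) => v {}V.
have extend (z : 'cV[F]_m) : L *m z = 0 -> (v *m z) 0 0 < 0 ->
    (forall i, (V *m z) i 0 < 0) ->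
    exists z : 'cV[F]_m, L *m z = 0 /\ forall i, (col_mx v V *m z) i 0 < 0.
  move=> Lz vz Vz; exists z; split=> // i; rewrite mul_col_mx mxE.
  by case: splitP => [k _|k _] //; rewrite ord1.
have [[z [Lz Vz]]|[w [w_ge0 w_neq0 wL]]] := IHp V; last first.
  right; exists (row_mx 0 w); split.
  - by move=> i; rewrite mxE; case: splitP => k _; rewrite ?[X in _ <= X]mxE.
  - by rewrite row_mx_eq0 negb_and w_neq0 orbT.
  - by rewrite mul_row_col mul0mx add0r.
have [vL|vNL] := boolP (v <= L)%MS.
  right; exists (row_mx 1 0); split.
  - by move=> i; rewrite mxE; case: splitP => k _; rewrite !mxE ?ler0n.
  - by rewrite row_mx_eq0 negb_and oner_eq0.
  - by rewrite mul_row_col mul0mx addr0 mul1mx.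
(* As v is not in the row space of L, some f vanishing on L separates it. *)
have [f Lf vf] : exists2 f : 'cV[F]_m, L *m f = 0 & (v *m f) 0 0 = 1.
  have /rV0Pn[k] : v *m cokermx L != 0 by rewrite -submxE.
  set e := _ 0 k => e_neq0; exists (e^-1 *: col k (cokermx L)).
    by rewrite -scalemxAr colE mulmxA mulmx_coker mul0mx scaler0.
  by rewrite -scalemxAr colE mulmxA -colE [LHS]mxE [X in _ * X]mxE -/e mulVf.
have perturb (z1 z2 : 'cV[F]_m) : L *m z1 = 0 -> L *m z2 = 0 ->
    (forall i, (V *m z1) i 0 < 0) ->
    exists e, [/\ 0 < e, L *m (z1 + e *: z2) = 0
                 & forall i, (V *m (z1 + e *: z2)) i 0 < 0].
  move=> L1 L2 V1; have [e e0 he] := small_perturbation (V *m z2) V1.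
  by exists e; rewrite !mulmxDr -!scalemxAr L1 L2 scaler0 addr0.
have vE (z1 z2 : 'cV[F]_m) e :
    (v *m (z1 + e *: z2)) 0 0 = (v *m z1) 0 0 + e * (v *m z2) 0 0.
  by rewrite mulmxDr -scalemxAr !mxE.
have [{Lz Vz}z Lz [Vz vz_neq0]] : exists2 z : 'cV[F]_m,
    L *m z = 0 & (forall i, (V *m z) i 0 < 0) /\ (v *m z) 0 0 != 0.
  have [vz0|] := eqVneq ((v *m z) 0 0) 0; last by exists z.
  have [e [e_gt0 Le Ve]] := perturb z f Lz Lf Vz.
  by exists (z + e *: f); rewrite // vE vz0 vf add0r mulr1 gt_eqF.
have [vz_lt0|vz_gt0] : (v *m z) 0 0 < 0 \/ 0 < (v *m z) 0 0.
  by move: vz_neq0; rewrite neq_lt => /orP[]; [left|right].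
  by left; apply: (extend z).
(* Row i of V + a *m v is the projection of row i of V along v. *)
pose a : 'cV[F]_p := - ((v *m z) 0 0)^-1 *: (V *m z).
have a_ge0 i : 0 <= a i 0.
  by rewrite mxE mulNr -mulrN mulr_ge0 ?invr_ge0 ?oppr_ge0 ?ltW.
have az : (V + a *m v) *m z = 0.
  rewrite mulmxDl -mulmxA [v *m z]mx11_scalar mul_mx_scalar scalerA mulrN.
  by rewrite divff // scaleN1r subrr.
have [[y [Ly Vy]]|[w [w_ge0 w_neq0 wL]]] := IHp (V + a *m v); last first.
  right; exists (row_mx (w *m a) w); split.
  - move=> i; rewrite mxE; case: splitP => k _ //.
    by rewrite ord1 mxE sumr_ge0 // => j _; rewrite mulr_ge0.
  - by rewrite row_mx_eq0 negb_and w_neq0 orbT.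
  - by rewrite mul_row_col addrC -mulmxA -mulmxDr.
(* Correcting y by a multiple of z makes it vanish on v without changing its
   values on the projected rows; subtracting a little of f then makes it
   negative on v as well. *)
left; pose y' := y - ((v *m y) 0 0 / (v *m z) 0 0) *: z.
have vy' : v *m y' = 0.
  apply/matrixP => i j; rewrite !ord1 /y' -scaleNr vE.
  by rewrite mulNr divfK // subrr mxE.
have Ly' : L *m y' = 0 by rewrite /y' mulmxBr -scalemxAr Ly Lz scaler0 subr0.
have Vy' i : (V *m y') i 0 < 0.
  have -> : V *m y' = (V + a *m v) *m y'.
    by rewrite mulmxDl -mulmxA vy' mulmx0 addr0.
  by rewrite /y' mulmxBr -scalemxAr az scaler0 subr0.
have [|e [e_gt0 Le Ve]] := perturb y' (- f) Ly' _ Vy'.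
  by rewrite mulmxN Lf oppr0.
apply: (extend _ Le _ Ve).
rewrite vE vy' [X in X + _]mxE add0r mulmxN [X in _ * X]mxE vf.
by rewrite mulrN1 oppr_lt0.
Qed.

(** Membership of [s] in the regular triangulation has a certificate, or its
    failure has one.  [gordan_mod] is applied to the homogenised system in
    [(y, t)]: [y . a_j = c_j t] for [j] in [s], [y . a_j < c_j t] for the other
    [j], and [0 < t]. *)
Lemma regular_face_alternative (F : realFieldType) (d n : nat)
  (A : 'M[F]_(d, n)) (c : 'rV[F]_n) (s : {set 'I_n}) :
  (exists y : 'rV[F]_d,
     (forall j, j \in s -> (y *m A) 0 j = c 0 j) /\
     (forall j, j \notin s -> (y *m A) 0 j < c 0 j)) \/
  (exists w : 'cV[F]_n,
     [/\ w != 0, A *m w = 0, forall j, j \notin s -> 0 <= w j 0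
       & (c *m w) 0 0 <= 0]).
Proof.
pose M : 'M_(n, d + 1) := row_mx A^T (- c^T).
pose N : 'rV[F]_(d + 1) := row_mx 0 (-1).
pose D : 'M[F]_n := diag_mx (\row_j (j \in s)%:R).
pose E : 'M[F]_n := diag_mx (\row_j (j \notin s)%:R).
pose one : 'cV[F]_n := const_mx 1.
(* D and E keep the rows in s and outside s; in V the rows in s are replaced by
   copies of N, the constraint 0 < t, so that V is indexed by all columns. *)
have [[z [Lz Vz]]|[w [w_ge0 w_neq0 /submxP[x wL]]]] :=
  gordan_mod (D *m M) (col_mx N (E *m M + D *m one *m N)).
- left; rewrite -(vsubmxK z) in Lz Vz.
  move: (usubmx z) (dsubmx z) Lz Vz => {z} y t Lz Vz.
  have Nz : (N *m col_mx y t) 0 0 = - t 0 0.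
    by rewrite mul_row_col mul0mx add0r mulNmx mul1mx mxE.
  have Mz j : (M *m col_mx y t) j 0 = (y^T *m A) 0 j - t 0 0 * c 0 j.
    rewrite mul_row_col [t]mx11_scalar mul_mx_scalar scalerN -[A^T *m y]trmxK.
    by rewrite trmx_mul trmxK !mxE eqxx mulr1n.
  have t_gt0 : 0 < t 0 0.
    by have := Vz (lshift n 0); rewrite mul_col_mx col_mxEu Nz oppr_lt0.
  exists ((t 0 0)^-1 *: y^T); split=> j js.
    have yj : (y^T *m A) 0 j = t 0 0 * c 0 j.
      apply/eqP; rewrite -subr_eq0 -Mz; move/matrixP/(_ j 0): Lz.
      by rewrite -mulmxA mul_diag_mx mxE !mxE js mul1r => ->.
    by rewrite -scalemxAl mxE yj mulKf ?gt_eqF.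
  have yj : (y^T *m A) 0 j < t 0 0 * c 0 j.
    rewrite -subr_lt0 -Mz; have := Vz (rshift 1 j).
    rewrite mul_col_mx col_mxEd mulmxDl mxE -!mulmxA !mul_diag_mx.
    rewrite [X in X + _]mxE [X in _ + X]mxE.
    rewrite [(\row_j (j \notin s)%:R) 0 j]mxE [(\row_j (j \in s)%:R) 0 j]mxE.
    by rewrite js (negPf js) mul1r mul0r addr0.
  by rewrite -scalemxAl mxE mulrC ltr_pdivrMr // mulrC.
right; rewrite -(hsubmxK w) in w_ge0 w_neq0 wL.
move: (lsubmx w) (rsubmx w) w_ge0 w_neq0 wL => {w} a w w_ge0 w_neq0 wL.
have a_ge0 : 0 <= a 0 0 by have := w_ge0 (lshift n 0); rewrite row_mxEl.
have {}w_ge0 j : 0 <= w 0 j by have := w_ge0 (rshift 1 j); rewrite row_mxEr.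
pose W := w *m E - x *m D; pose S := a + w *m D *m one.
have WM : W *m M = - S *m N.
  rewrite mulNmx [S *m N]mulmxDl mulmxBl -[x *m D *m M]mulmxA -wL.
  rewrite mul_row_col [w *m (_ + _)]mulmxDr !mulmxA [a *m N + _]addrCA.
  by rewrite opprD addNKr.
have WE j : W 0 j = if j \in s then - x 0 j else w 0 j.
  rewrite /W !mul_mx_diag !mxE; case: (j \in s).
    by rewrite mulr0 mulr1 add0r.
  by rewrite mulr0 mulr1 subr0.
have SE : S 0 0 = a 0 0 + \sum_(j in s) w 0 j.
  rewrite /S mul_mx_diag !mxE; congr (_ + _); rewrite [RHS]big_mkcond /=.
  by apply: eq_bigr => j _; rewrite !mxE mulr1 mulr_natr mulrb.
move: WM; rewrite /M /N !mul_mx_row mulmx0 !mulmxN mulNmx opprK mulmx1.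
move=> /eq_row_mx[WA Wc].
have {}WA : A *m W^T = 0 by rewrite -[A]trmxK -trmx_mul WA trmx0.
have {}Wc : c *m W^T = - S.
  have : (W *m c^T)^T = - S^T by rewrite -[in RHS]Wc linearN /= opprK.
  by rewrite trmx_mul trmxK [S]mx11_scalar tr_scalar_mx.
have S_ge0 : 0 <= S 0 0 by rewrite SE addr_ge0 // sumr_ge0.
exists W^T; split=> //.
- apply: contraNneq w_neq0 => W0.
  have {}W0 : W = 0 by rewrite -[W]trmxK W0 trmx0.
  have S0 : S = 0 by apply/eqP; rewrite -oppr_eq0 -Wc W0 trmx0 mulmx0.
  move/matrixP/(_ 0 0): S0; rewrite SE mxE => /eqP.
  rewrite paddr_eq0 ?sumr_ge0 // psumr_eq0 // => /andP[/eqP a0 /allP ws0].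
  rewrite row_mx_eq0 [a]mx11_scalar a0 raddf0 eqxx /=.
  apply/eqP/rowP => j; rewrite mxE.
  have [js|js] := boolP (j \in s).
    by have := ws0 j (mem_index_enum _); rewrite js => /eqP.
  by move/rowP/(_ j): W0; rewrite WE (negPf js) mxE.
- by move=> j /negPf js; rewrite mxE WE js.
- by rewrite Wc mxE oppr_le0.
Qed.

(** * Rational vectors and lattice points *)

Definition mx_to_rat (m n : nat) (M : 'M[int]_(m, n)) : 'M[rat]_(m, n) :=
  map_mx intr M.

Lemma mx_to_ratM (m n p : nat) (M : 'M[int]_(m, n)) (N : 'M[int]_(n, p)) :
  mx_to_rat (M *m N) = mx_to_rat M *m mx_to_rat N.
Proof. exact: map_mxM. Qed.

Lemma mx_to_rat_tr (m n : nat) (M : 'M[int]_(m, n)) :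
  mx_to_rat M^T = (mx_to_rat M)^T.
Proof. by apply/matrixP => i j; rewrite !mxE. Qed.

Lemma mx_to_rat_inj (m n : nat) : injective (@mx_to_rat m n).
Proof.
move=> M N /matrixP MN; apply/matrixP => i j.
by have := MN i j; rewrite !mxE => /intr_inj.
Qed.

Lemma mx_to_rat_real (R : realType) (m n : nat) (M : 'M[int]_(m, n)) :
  map_mx ratr (mx_to_rat M) = mx_to_real R M.
Proof. by apply/matrixP => i j; rewrite !mxE; exact: ratr_int. Qed.

Lemma mx_to_realM (R : realType) (m n p : nat) (M : 'M[int]_(m, n))
  (N : 'M[int]_(n, p)) :
  mx_to_real R (M *m N) = mx_to_real R M *m mx_to_real R N.
Proof. exact: map_mxM. Qed.

Lemma clear_denominators (m n : nat) (w : 'M[rat]_(m, n)) :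
  exists (k : int) (x : 'M[int]_(m, n)),
    0 < k /\ mx_to_rat x = k%:~R *: w.
Proof.
pose D (p : 'I_m * 'I_n) := denq (w p.1 p.2).
pose x := \matrix_(i, j) (numq (w i j) * \prod_(p | p != (i, j)) D p).
exists (\prod_p D p), x.
split; first by rewrite prodr_gt0 // => p _; exact: denq_gt0.
apply/matrixP => i j; rewrite !mxE [in RHS](bigD1 (i, j)) //= !intrM.
rewrite mulrAC -[X in _ = _ * X * _]divq_num_den mulrCA.
by rewrite divff ?mulr1 // intr_eq0 denq_neq0.
Qed.

(** The rational kernel of [A] has dimension [n - d] and is spanned by integer
    vectors, hence by the [n - d] columns of [B]. *)
Lemma kernel_basis_free (R : realType) (d n : nat) (A : 'M[int]_(d, n))
  (B : 'M[int]_(n, n - d)) :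
  \rank (mx_to_real R A) = d -> generates_kernel A B ->
  forall z : 'cV[int]_(n - d), B *m z = 0 -> z = 0.
Proof.
move=> rkA BP z Bz.
have rkAQ : \rank (mx_to_rat A) = d.
  by rewrite -[RHS]rkA -(mxrank_map (ratr : rat -> R)) mx_to_rat_real.
have kerB : (kermx (mx_to_rat A)^T <= (mx_to_rat B)^T)%MS.
  apply/row_subP => i; set v := row i _.
  have vA : v *m (mx_to_rat A)^T = 0 by rewrite -row_mul mulmx_ker row0.
  have [k [x [k_gt0 xE]]] := clear_denominators v.
  have kn0 : (k%:~R : rat) != 0 by rewrite intr_eq0 gt_eqF.
  have /BP[y yE] : A *m x^T = 0.
    apply: mx_to_rat_inj; rewrite mx_to_ratM mx_to_rat_tr xE linearZ /=.
    rewrite -scalemxAr -[mx_to_rat A]trmxK -trmx_mul vA trmx0 scaler0.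
    by rewrite /mx_to_rat map_mx0.
  rewrite -(eqmx_scale _ kn0) -xE -[x]trmxK yE -mx_to_rat_tr trmx_mul.
  by rewrite mx_to_ratM submxMl.
have freeB : row_free (mx_to_rat B)^T.
  rewrite /row_free eqn_leq rank_leq_row /=.
  by rewrite -{1}rkAQ -[\rank (mx_to_rat A)]mxrank_tr -mxrank_ker mxrankS.
apply: mx_to_rat_inj; rewrite -[LHS]trmxK -[RHS]trmxK; congr (_^T).
by apply: (row_free_inj freeB); rewrite -!trmx_mul -!mx_to_ratM Bz mulmx0.
Qed.

(** * Optimality for a relaxation *)

Definition relax_opt (d n : nat) (A : 'M[int]_(d, n)) (c : 'rV[int]_n)
  (t : {set 'I_n}) (x : 'cV[int]_n) : Prop :=
  forall x', gr_feasible A t (A *m x) x' -> (c *m x) 0 0 <= (c *m x') 0 0.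

Definition maximally_relaxed (d n : nat) (A : 'M[int]_(d, n)) (c : 'rV[int]_n)
  (t : {set 'I_n}) (u : 'cV[int]_n) : Prop :=
  relax_opt A c t u /\ forall i, i \notin t -> ~ relax_opt A c (i |: t) u.

Section Relaxations.
Variables (d n : nat) (A : 'M[int]_(d, n)) (c : 'rV[int]_n).
Implicit Types (s t : {set 'I_n}) (u x y e : 'cV[int]_n).

Lemma costD x y : (c *m (x + y)) 0 0 = (c *m x) 0 0 + (c *m y) 0 0.
Proof. by rewrite mulmxDr mxE. Qed.

Lemma costB x y : (c *m (x - y)) 0 0 = (c *m x) 0 0 - (c *m y) 0 0.
Proof. by rewrite mulmxBr !mxE. Qed.

Lemma nonneg_gr_feasible t x : nonneg x -> gr_feasible A t (A *m x) x.
Proof. by move=> x_ge0; split. Qed.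

Lemma relax_opt_sub s t x : s \subset t ->
  relax_opt A c t x -> relax_opt A c s x.
Proof.
move=> /fintype.subsetP st xP x' [Ax' x'_ge0]; apply: xP; split=> // j jt.
by apply: x'_ge0; apply: contraNN jt; apply: st.
Qed.

Lemma relax_opt_shift t x e : (forall j, j \notin t -> e j 0 = 0) ->
  relax_opt A c t x -> relax_opt A c t (x + e).
Proof.
move=> e0 xP x' [Ax' x'_ge0].
have /xP : gr_feasible A t (A *m x) (x' - e).
  split=> [|j jt]; first by rewrite mulmxBr Ax' mulmxDr addrK.
  by rewrite !mxE e0 // oppr0 addr0 x'_ge0.
by rewrite costB costD lerBrDr.
Qed.

Lemma relax_opt_eqoff t x y : (forall j, j \notin t -> x j 0 = y j 0) ->
  relax_opt A c t x -> relax_opt A c t y.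
Proof.
move=> xy xP; rewrite -[y](subrKC x); apply: relax_opt_shift xP => j jt.
by rewrite !mxE xy // subrr.
Qed.

Lemma relax_opt_ip_optimal t x : nonneg x -> relax_opt A c t x ->
  ip_optimal A c (A *m x) x.
Proof. by move=> x_ge0 xP; split=> // x' [Ax' x'_ge0]; apply: xP; split. Qed.

Lemma opt_solsP x : opt_sols A c x <-> nonneg x /\ ip_optimal A c (A *m x) x.
Proof.
split=> [[b _ xb]|[x_ge0 xP]]; first by have [[xbE x_ge0] _] := xb; rewrite xbE.
by exists (A *m x) => //; exists x.
Qed.

Definition lift_off t x : 'cV[int]_n :=
  \col_j if j \in t then `|x j 0| else 0.

Lemma lift_off_nonneg t x :
  (forall j, j \notin t -> 0 <= x j 0) -> nonneg (x + lift_off t x).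
Proof.
move=> x_ge0 j; rewrite !mxE; case: ifPn => [_|/x_ge0]; last by rewrite addr0.
by rewrite addrC -lerBlDr sub0r ler_normr lexx orbT.
Qed.

(** Adding a large vector supported on [t] makes a competitor non-negative
    without changing cost differences, so genericity, which speaks of
    non-negative solutions, also gives uniqueness for the relaxations. *)
Lemma relax_opt_uniq t x x' : generic A c -> nonneg x -> relax_opt A c t x ->
  gr_feasible A t (A *m x) x' -> (c *m x') 0 0 <= (c *m x) 0 0 -> x' = x.
Proof.
move=> Ac x_ge0 xP [Ax' x'_ge0] cx'.
pose e := lift_off t x'.
have xe_ge0 : nonneg (x + e).
  by move=> j; rewrite !mxE addr_ge0 //; case: ifP.
have x'e_ge0 : nonneg (x' + e) by exact: lift_off_nonneg.
have eP : relax_opt A c t (x + e).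
  by apply: relax_opt_shift xP => j /negPf jt; rewrite mxE jt.
have xe_opt := relax_opt_ip_optimal xe_ge0 eP.
have x'e_opt : ip_optimal A c (A *m (x + e)) (x' + e).
  split; first by split=> //; rewrite !mulmxDr Ax'.
  move=> z /(proj2 xe_opt); apply: le_trans.
  by rewrite !costD lerD2r.
have [|z [_ zP]] := Ac (A *m (x + e)); first by exists (x + e).
by apply: (addIr e); rewrite -(zP _ xe_opt) -(zP _ x'e_opt).
Qed.

(** * Standard pairs *)

Lemma translateP u t y : translate u t y <->
  forall j, if j \in t then u j 0 <= y j 0 else y j 0 == u j 0.
Proof.
have sumE (m : 'I_n -> nat) j :
    (\sum_(i in t) (m i)%:Z *: (delta_mx i 0 : 'cV[int]_n)) j 0 =
    if j \in t then (m j)%:Z else 0.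
  rewrite summxE big_mkcond (bigD1 j) //= big1 ?addr0 => [|i ij].
    by rewrite !mxE !eqxx mulr1.
  by case: ifP => // _; rewrite !mxE eq_sym (negPf ij) mulr0.
split=> [[m ->] j|uy].
  by rewrite !mxE sumE; case: (j \in t); rewrite ?addr0 ?lerDl.
exists (fun j => absz (y j 0 - u j 0)%R); apply/colP => j.
rewrite !mxE sumE; have := uy j; case: (j \in t) => [le_uy|/eqP->].
  by rewrite gez0_abs ?subr_ge0 // subrKC.
by rewrite addr0.
Qed.

(** A competitor [x'] of [u] in the relaxation corresponds to the competitor
    [x' + e] of [u + e] in the integer program, with [e] supported on [t] and
    large enough to cancel the negative coordinates of [x']. *)
Lemma translate_opt_sols u t : nonneg u ->
  translate u t `<=` opt_sols A c <-> relax_opt A c t u.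
Proof.
move=> u_ge0; split=> [uP x' [Ax' x'_ge0]|uP y /translateP uy].
  pose e := lift_off t x'.
  have /uP/opt_solsP[_ [_ ue_opt]] : translate u t (u + e).
    apply/translateP => j; rewrite !mxE.
    by case: (j \in t); rewrite ?addr0 ?lerDl.
  have /ue_opt : ip_feasible A (A *m (u + e)) (x' + e).
    by split; [rewrite !mulmxDr Ax'|exact: lift_off_nonneg].
  by rewrite !costD lerD2r.
have y_ge0 : nonneg y.
  move=> j; have := uy j; case: ifP => _ => [|/eqP->]; last exact: u_ge0.
  exact: le_trans.
apply/opt_solsP; split=> //; apply: (@relax_opt_ip_optimal t) => //.
by apply: relax_opt_eqoff uP => j jt; have := uy j; rewrite (negPf jt) => /eqP.
Qed.

Lemma maximally_relaxed_eqoff t x y : (forall j, j \notin t -> x j 0 = y j 0) ->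
  maximally_relaxed A c t x -> maximally_relaxed A c t y.
Proof.
move=> xy [xP xN]; split=> [|i it yP]; first exact: relax_opt_eqoff xP.
apply: (xN i it); apply: relax_opt_eqoff yP => j.
by rewrite !inE negb_or => /andP[_ /xy].
Qed.

Lemma maximally_relaxed_eq s t u : maximally_relaxed A c t u ->
  relax_opt A c s u -> t \subset s -> s = t.
Proof.
move=> [_ uN] uP ts; apply/eqP; rewrite finset.eqEsubset ts andbT.
apply/fintype.subsetP => i si; apply/negPn/negP => /uN; apply.
by apply: relax_opt_sub uP; rewrite finset.subUset finset.sub1set si.
Qed.

(** Normalises [u] so that its support avoids [t], as required of the first
    component of an admissible pair. *)
Definition erase t u : 'cV[int]_n := \col_j if j \in t then 0 else u j 0.

Lemma erase_eqoff t u j : j \notin t -> u j 0 = erase t u j 0.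
Proof. by move=> /negPf jt; rewrite mxE jt. Qed.

Lemma erase_nonneg t u : nonneg u -> nonneg (erase t u).
Proof. by move=> u_ge0 j; rewrite mxE; case: ifP. Qed.

Lemma supp_erase t u : supp (erase t u) \subset ~: t.
Proof.
by apply/fintype.subsetP => j; rewrite !inE mxE; case: ifP; rewrite ?eqxx.
Qed.

Lemma translate_self u t : translate u t u.
Proof. by apply/translateP => j; case: ifP. Qed.

Lemma supp_off t u j : supp u \subset ~: t -> j \in t -> u j 0 = 0.
Proof.
move=> /fintype.subsetP ut jt; apply/eqP; apply: contraTT jt => uj.
by have := ut j; rewrite !inE; apply.
Qed.

Variable R : realType.

(** If [s] is not a face, duality provides a non-zero integer direction [x] in
    the kernel of [A], non-negative outside [s] and with non-positive cost.
    Then [u + x] is a second minimiser. *)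
Lemma face_of_relax_opt s u : generic A c -> nonneg u -> relax_opt A c s u ->
  face R A c s.
Proof.
move=> Ac u_ge0 uP.
have [[y [ys yNs]]|[w [w_neq0 Aw w_ge0 cw]]] :=
  regular_face_alternative (mx_to_rat A) (mx_to_rat c) s.
  exists (map_mx ratr y); rewrite -mx_to_rat_real -map_mxM.
  have cE j : (c 0 j)%:~R = ratr (mx_to_rat c 0 j) :> R.
    by rewrite mxE; exact/esym/ratr_int.
  by split=> j js; rewrite mxE cE; [rewrite ys|rewrite ltr_rat yNs].
have [k [x [k_gt0 xE]]] := clear_denominators w.
have k_gt0' : (0 : rat) < k%:~R by rewrite ltr0z.
have x0 : u + x = u.
  apply: (relax_opt_uniq Ac u_ge0 uP).
    split=> [|j js].
      rewrite mulmxDr; have -> : A *m x = 0; last by rewrite addr0.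
      apply: mx_to_rat_inj; rewrite mx_to_ratM xE -scalemxAr Aw scaler0.
      by rewrite /mx_to_rat map_mx0.
    rewrite mxE addr_ge0 // -(ler0z rat).
    have -> : (x j 0)%:~R = mx_to_rat x j 0 by rewrite mxE.
    by rewrite xE mxE mulr_ge0 ?w_ge0 // ltW.
  rewrite costD gerDl -(lerz0 rat).
  have -> : ((c *m x) 0 0)%:~R = mx_to_rat (c *m x) 0 0 by rewrite [RHS]mxE.
  by rewrite mx_to_ratM xE -scalemxAr mxE pmulr_rle0.
case/eqP: w_neq0; have /eqP := xE.
have -> : x = 0 by apply: (addrI u); rewrite x0 addr0.
rewrite /mx_to_rat map_mx0 eq_sym scaler_eq0 gt_eqF //= => /eqP; exact.
Qed.

Lemma admissible_pairP u t : face R A c t -> supp u \subset ~: t ->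
  admissible_pair R A c u t <-> nonneg u /\ relax_opt A c t u.
Proof.
move=> tF ut; split=> [[_ /opt_solsP[u_ge0 _] _ uS]|[u_ge0 uP]].
  by split=> //; apply/translate_opt_sols.
have /(translate_opt_sols _ u_ge0) uS := uP.
by split=> //; apply: uS; exact: translate_self.
Qed.

(** An inclusion [S(u, t) <= S(v, t')] forces [t] to be a subset of [t'] and [u]
    to agree with [v] outside [t'], hence to be optimal for the relaxation at
    [t'].  Conversely, if [u] is optimal for the relaxation at [i |: t], this
    set is a face, and erasing the coordinates of [u] in it gives a larger
    admissible pair. *)
Lemma standard_pairP u t : generic A c -> face R A c t ->
  standard_pair R A c u t <->
  [/\ nonneg u, supp u \subset ~: t & maximally_relaxed A c t u].
Proof.
move=> Ac tF; split=> [[uA uN]|[u_ge0 ut uT]].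
  have [_ _ ut _] := uA; have [u_ge0 uP] := (admissible_pairP tF ut).1 uA.
  split=> //; split=> // i it iP; apply: (uN (erase (i |: t) u) (i |: t)).
    apply/admissible_pairP; [exact: face_of_relax_opt iP|exact: supp_erase|].
    split; first exact: erase_nonneg.
    by apply: relax_opt_eqoff iP => j; exact: erase_eqoff.
  split=> [y /translateP uy|sub].
    apply/translateP => j; rewrite mxE !inE; have := uy j.
    case: (j \in t) => [uj|/eqP->]; first by rewrite orbT (le_trans _ uj).
    by case: (_ || _); rewrite ?u_ge0.
  have /sub/translateP/(_ i) :
      translate (erase (i |: t) u) (i |: t) (u + delta_mx i 0).
    apply/translateP => j; rewrite !mxE !inE.
    have [->|ji] := eqVneq j i; first by rewrite addr_ge0.
    by case: (_ || _); rewrite addr0.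
  rewrite (negPf it) !mxE !eqxx -[X in _ == X]addr0.
  by rewrite (inj_eq (addrI _)).
have [uP _] := uT.
split; first by apply/admissible_pairP.
move=> v t' vA [sub nsub]; have [t'F _ vt' _] := vA.
have [v_ge0 vP] := (admissible_pairP t'F vt').1 vA.
have /translateP uv := sub _ (translate_self u t).
have uP' : relax_opt A c t' u.
  apply: relax_opt_eqoff vP => j jt.
  by have := uv j; rewrite (negPf jt) => /eqP.
have tt' : t \subset t'.
  apply/fintype.subsetP => j jt; apply: contraT => jt'.
  have /sub/translateP/(_ j) : translate u t (u + delta_mx j 0).
    apply/translateP => i; rewrite !mxE.
    have [->|_] := eqVneq i j; first by rewrite jt lerDl.
    by rewrite addr0; case: ifP.
  have := uv j; rewrite (negPf jt') => /eqP <-.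
  by rewrite !mxE !eqxx -[X in _ == X]addr0 (inj_eq (addrI _)).
have t'E := maximally_relaxed_eq uT uP' tt'; apply: nsub.
suff -> : v = u by rewrite t'E.
apply/colP => j; have := uv j; rewrite t'E; case: ifP => [jt _|_ /eqP //].
by rewrite (supp_off ut jt) (supp_off _ jt) // -t'E.
Qed.

(** * Standard polytopes *)

Lemma standard_polytopeP k (B : 'M[int]_(n, k)) u t :
  generic A c -> generates_kernel A B ->
  (forall z : 'cV[int]_k, B *m z = 0 -> z = 0) -> nonneg u ->
  standard_polytope R B c u t <-> maximally_relaxed A c t u.
Proof.
move=> Ac BP Binj u_ge0.
(* A lattice point z of the polytope stands for the competitor u - B z. *)
have lattice_polyQ (rows : {set 'I_n}) (z : 'cV[int]_k) :
    polyQ R B c u rows (mx_to_real R z) <->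
    gr_feasible A (~: rows) (A *m u) (u - B *m z) /\
    (c *m (u - B *m z)) 0 0 <= (c *m u) 0 0.
  have ABz : A *m (u - B *m z) = A *m u.
    have -> : A *m (u - B *m z) = A *m u - A *m (B *m z) by rewrite mulmxBr.
    suff -> : A *m (B *m z) = 0 by rewrite subr0.
    by apply/BP; exists z.
  rewrite /polyQ /= -!mx_to_realM mulNmx.
  have -> : (mx_to_real R (- (c *m B *m z)) 0 0 <= 0) =
            ((c *m (u - B *m z)) 0 0 <= (c *m u) 0 0).
    rewrite mulmxBr mulmxA [X in X <= _]mxE lerz0 [X in X <= _]mxE oppr_le0.
    by rewrite [(c *m u - _) 0 0]mxE [X in _ + X]mxE gerBl.
  split=> [[Qz cz]|[[_ Qz] cz]]; split=> //.
    by split=> // j; rewrite inE negbK => /Qz; rewrite !mxE ler_int subr_ge0.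
  move=> j jr; have := Qz j.
  by rewrite inE negbK jr !mxE ler_int subr_ge0; apply.
have kerE x' : A *m x' = A *m u -> exists z, x' = u - B *m z.
  move=> Ax'; have /BP[z zE] : A *m (u - x') = 0 by rewrite mulmxBr Ax' subrr.
  by exists z; rewrite -zE subKr.
have real0 (z : 'cV[int]_k) : mx_to_real R z = 0 -> z = 0.
  move=> /matrixP z0; apply/matrixP => i j; have := z0 i j; rewrite !mxE.
  by move/eqP; rewrite intr_eq0 => /eqP.
(* Relaxing the set s amounts to keeping the inequalities of its complement. *)
have relaxE s : relax_opt A c s u <->
    forall z : 'cV[int]_k, polyQ R B c u (~: s) (mx_to_real R z) -> z = 0.
  split=> [uP z /lattice_polyQ|zP x' x'F].
    rewrite finset.setCK => -[zF cz]; apply: Binj.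
    apply: oppr_inj; rewrite oppr0; apply: (addrI u).
    by rewrite addr0; exact: relax_opt_uniq uP zF cz.
  rewrite leNgt; apply/negP => cx'.
  have [z zE] := kerE _ (proj1 x'F).
  have z0 : z = 0.
    by apply: zP; apply/lattice_polyQ; rewrite finset.setCK -zE (ltW cx').
  by move: cx'; rewrite zE z0 mulmx0 subr0 ltxx.
have QE :
    polyQ R B c u (~: t) `&` int_points R k = [set 0] <-> relax_opt A c t u.
  split=> [Q0|/relaxE uP].
    apply/relaxE => z zQ; apply: real0.
    suff : (polyQ R B c u (~: t) `&` int_points R k) (mx_to_real R z).
      by rewrite Q0.
    by split=> //; exists z.
  apply/seteqP; split=> [r [zQ [z _ zE]]|_ ->].
    by move: zQ; rewrite -zE => /uP ->; rewrite /= /mx_to_real map_mx0.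
  have real00 : mx_to_real R (0 : 'cV[int]_k) = 0.
    by rewrite /mx_to_real map_mx0.
  split; last by exists 0.
  by rewrite -real00; apply/lattice_polyQ; rewrite mulmx0 subr0 finset.setCK.
have rowsE i : ~: t :\ i = ~: (i |: t).
  by rewrite finset.setCU finset.setDE finset.setIC.
split=> [[/QE uP uN]|[/QE uP uN]]; split=> // i it.
  move=> /relaxE iP.
  have [|z [zQ [x _ xE] z_neq0]] := uN i; first by rewrite inE.
  apply: z_neq0; move: zQ; rewrite rowsE -xE => /iP ->.
  by rewrite /mx_to_real map_mx0.
apply: contrapT => zN; apply: (uN i); first by rewrite inE in it.
apply/relaxE => z zQ; apply: contrapT => z_neq0; apply: zN.
exists (mx_to_real R z); split; [by rewrite rowsE|by exists z|by move=> /real0].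
Qed.

(** * Group relaxations and associated sets *)

Lemma maximal_face_exists t : face R A c t ->
  exists2 s, maximal_face R A c s & t \subset s.
Proof.
pose P s := `[< face R A c s >]; move=> /asboolP tP.
have [s /maxsetP[/asboolP sF sM] ts] := @maxset_exists _ P t tP.
exists s => //; split=> // s' /asboolP s'F; apply/negP => /andP[ss' s's].
by rewrite (sM _ s'F ss') subxx in s's.
Qed.

Lemma col_subsetB p q (M N : 'M[R]_(p, q)) (s : {set 'I_q}) :
  col_subset (M - N) s = col_subset M s - col_subset N s.
Proof. by apply/matrixP => i k; rewrite !mxE. Qed.

Lemma col_subsetM p q r (M : 'M[R]_(p, q)) (N : 'M[R]_(q, r))
  (s : {set 'I_r}) :
  col_subset (M *m N) s = M *m col_subset N s.
Proof.
by apply/matrixP => i k; rewrite !mxE; apply: eq_bigr => j _; rewrite !mxE.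
Qed.

(** The reduced cost vanishes on [s]: as [c_s = y A_s] lies in the row space of
    [A_s], the partial inverse satisfies [c_s A_s^-1 A_s = c_s].  The sum over
    the complement of [t] is therefore a full scalar product, in which the
    multiple of [A] contributes a constant on the fibre of [b]. *)
Lemma gr_costE s t b x : maximal_face R A c s -> t \subset s -> A *m x = b ->
  gr_cost (reduced_cost R A c s) t x =
  ((c *m x) 0 0)%:~R - (col_subset (mx_to_real R c) s *m
    pinvmx (col_subset (mx_to_real R A) s) *m mx_to_real R b) 0 0.
Proof.
move=> [[y [ys _]] _] /fintype.subsetP ts <-.
set ct := reduced_cost R A c s.
have ct0 j : j \in s -> ct 0 j = 0.
  move=> js; rewrite -(enum_rankK_in js js).
  set k := enum_rank_in js j; rewrite -[LHS]/(ct 0 (enum_val k)).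
  have -> : ct 0 (enum_val k) = col_subset ct s 0 k by rewrite [RHS]mxE.
  suff -> : col_subset ct s = 0 by rewrite mxE.
  have csE : col_subset (mx_to_real R c) s = y *m col_subset (mx_to_real R A) s.
    rewrite -col_subsetM; apply/rowP => i.
    by rewrite [RHS]mxE ys ?enum_valP // !mxE.
  rewrite /ct /reduced_cost col_subsetB.
  by rewrite col_subsetM csE mulmxKpV ?submxMl // subrr.
transitivity ((ct *m mx_to_real R x) 0 0).
  rewrite mxE /gr_cost [RHS](bigID (mem t)) /=.
  rewrite [X in _ = X + _]big1 ?add0r; last first.
    by move=> j jt; rewrite ct0 ?mul0r ?ts.
  by apply: eq_big => [j|j _]; rewrite ?inE // [mx_to_real _ _ _ _]mxE.
rewrite /ct /reduced_cost mulmxBl -[_ *m mx_to_real R A *m _]mulmxA.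
by rewrite -!mx_to_realM mxE [mx_to_real R (c *m x) 0 0]mxE [X in _ + X]mxE.
Qed.

Lemma gr_solvesP t b : face R A c t ->
  gr_solves R A c t b <->
  exists x, [/\ nonneg x, A *m x = b & relax_opt A c t x].
Proof.
move=> tF; split=> [[s [sM ts [x [[Ax xF] xP] x_ge0]]]|[x [x_ge0 Ax xP]]].
  exists x; split=> // x'; rewrite Ax => x'F; have [Ax' _] := x'F.
  have := xP x' x'F; rewrite (gr_costE sM ts Ax) (gr_costE sM ts Ax').
  by rewrite lerD2r ler_int.
have [s sM ts] := maximal_face_exists tF.
exists s; split=> //; exists x => //; split=> [|x' x'F].
  by rewrite -Ax; exact: nonneg_gr_feasible.
have [Ax' _] := x'F; rewrite (gr_costE sM ts Ax) (gr_costE sM ts Ax').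
by rewrite lerD2r ler_int; apply: xP; rewrite Ax.
Qed.

(** A point that solves the program for a larger face is the optimal solution of
    the program, so by genericity the same [u] is tested against all faces. *)
Lemma associatedP t : generic A c -> face R A c t ->
  associated R A c t <-> exists2 u, nonneg u & maximally_relaxed A c t u.
Proof.
move=> Ac tF; split=> [[_ [b [_ /gr_solvesP bP bN]]]|[u u_ge0 uT]].
  have [x [x_ge0 Ax xP]] := bP tF; exists x => //; split=> // i it iP.
  have iF := face_of_relax_opt Ac x_ge0 iP.
  apply: (bN _ iF); first by apply: finset.properUr; rewrite finset.sub1set.
  by apply/gr_solvesP => //; exists x.
have [uP _] := uT.
split=> //; exists (A *m u); split; first by exists u.
  by apply/gr_solvesP => //; exists u.
move=> t' t'F tt' /gr_solvesP[] // x [x_ge0 Ax xP].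
have xu : x = u.
  have [|z [_ zP]] := Ac (A *m u); first by exists u.
  rewrite -(zP u); last exact: relax_opt_ip_optimal uP.
  by apply/esym/zP; rewrite -Ax; exact: relax_opt_ip_optimal xP.
rewrite xu in xP; have t'E := maximally_relaxed_eq uT xP (proper_sub tt').
by rewrite t'E fintype.properxx in tt'.
Qed.

End Relaxations.

Theorem theorem3p10 (R : realType) (d n : nat) (A : 'M[int]_(d, n))
  (c : 'rV[int]_n) (B : 'M[int]_(n, n - d))
  (hrank : \rank (mx_to_real R A) = d)
  (hpointed : pointed (cone R A))
  (hker : forall u : 'cV[R]_n, nonneg u -> mx_to_real R A *m u = 0 -> u = 0)
  (hc : generic A c)
  (hB : generates_kernel A B)
  (t : {set 'I_n}) (ht : face R A c t) :
  [/\ forall u : 'cV[int]_n, nonneg u -> supp u \subset ~: t ->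
        (standard_pair R A c u t <-> standard_polytope R B c u t),
      associated R A c t <-> (exists u, standard_pair R A c u t)
    & associated R A c t <->
      (exists2 u : 'cV[int]_n, nonneg u & standard_polytope R B c u t)].
Proof.
have polyP u :
    nonneg u -> standard_polytope R B c u t <-> maximally_relaxed A c t u.
  exact: standard_polytopeP hc hB (kernel_basis_free hrank hB).
split=> [u u_ge0 ut||].
- rewrite polyP // standard_pairP //.
  by split=> [[]|uT].
- rewrite associatedP //.
  split=> [[u u_ge0 uT]|[u /standard_pairP[] // u_ge0 _ uT]].
    exists (erase t u); apply/standard_pairP => //; split.
    + exact: erase_nonneg.
    + exact: supp_erase.
    + by apply: maximally_relaxed_eqoff uT => j; exact: erase_eqoff.
  by exists u.
- rewrite associatedP //.
  by split=> -[u u_ge0 uT]; exists u => //; exact/(polyP _ u_ge0).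
Qed.
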